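(* Let $(X,\rho)$ be a metric space and $T:X\to X$ a mapping. Then the following two statements are equivalent: (1) There exists a cover $\mathcal{C}$ of $X$ by closed subsets of $X$ such that for every $S\in\mathcal{C}$: $T(S)\subseteq S$; $(S,\rho)$ is a complete subspace of $X$; and the restriction $T|_S:S\to S$ is a universal iterative contraction map on $(S,\rho)$ with some constant $k\in(0,1)$. (2) For each $x\in X$, the sequence $\{T^nx\}_{n=0}^\infty$ converges to a fixed point of $T$ in $X$ (which may depend on $x$).
   Context: $\mathbb{N}$ denotes the set of positive integers, and $T^n$ denotes the $n$-fold composition of $T$ with itself ($T^0$ is the identity). Definition. Let $(X,\rho)$ be a metric space, $T:X\to X$ a mapping and $k\in[0,1)$. $T$ is called a universal iterative contraction map with constant $k$ if both of the following hold: - for any distinct points $x,y\in X$ there exists $N_y^x\in\mathbb{N}$ such that $\rho(T^{N_y^x}x,T^{N_y^x}y)\leq k\,\rho(x,y)$; - for each $x\in X$ there exists $N_x^x\in\mathbb{N}$ such that $\rho(T^{N_x^x}x,T^{N_x^x+n}x)\leq k\,\rho(x,T^nx)$ for every $n\in\mathbb{N}$. A cover of $X$ is a family of subsets of $X$ whose union is $X$. *)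

(* Defs.v *)
From HB Require Import structures.
From mathcomp Require Import all_boot all_order all_algebra.
From mathcomp Require Import all_classical all_reals all_analysis.

Set Implicit Arguments.
Unset Strict Implicit.
Unset Printing Implicit Defensive.

Import Order.TTheory GRing.Theory Num.Theory.
Import numFieldNormedType.Exports.

Local Open Scope classical_set_scope.
Local Open Scope ring_scope.

(* A subset [S] of a metric space, coerced to the type [set_type S] of its
   points, already carries the induced uniformity and balls; the metric below
   is compatible with them. *)
Section metric_subspace.
Context {R : realType} {X : metricType R} (S : set X).

Definition sub_mdist (x y : S) : R := mdist (set_val x) (set_val y).

Lemma sub_mdist_ge0 (x y : S) : 0 <= sub_mdist x y.
Proof. exact: mdist_ge0. Qed.

Lemma sub_mdist_positivity (x y : S) : sub_mdist x y = 0 -> x = y.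
Proof. by move=> /mdist_positivity; rewrite !set_valE => /val_inj. Qed.

Lemma sub_ballEmdist (x : S) (d : R) : ball x d = [set y | sub_mdist x y < d].
Proof. by rewrite -[LHS]initial_ballE ballEmdist. Qed.

HB.instance Definition _ := PseudoMetric_isMetric.Build R (set_type S)
  sub_mdist_ge0 sub_mdist_positivity sub_ballEmdist.

End metric_subspace.

(* The axiom of [completeType], restated because [completeType] requires a
   pointed carrier whereas a subspace is only a [uniformType]. *)
Definition complete_space (M : uniformType) : Prop :=
  forall F : set_system M, ProperFilter F -> cauchy F -> exists l : M, F --> l.

Definition universal_iterative_contraction {R : realType} {M : metricType R}
    (T : M -> M) (k : R) : Prop :=
  [/\ 0 <= k < 1,
      forall x y : M, x <> y -> exists N : nat, (0 < N)%N /\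
        mdist (iter N T x) (iter N T y) <= k * mdist x y
    & forall x : M, exists N : nat, (0 < N)%N /\
        forall n : nat, (0 < n)%N ->
        mdist (iter N T x) (iter (N + n) T x) <= k * mdist x (iter n T x)].

Definition restriction {X : Type} (T : X -> X) (S : set X)
    (TS : set_fun S S T) : S -> S :=
  sigLR (mkfun_fun TS).

Lemma restrictionE {X : Type} (T : X -> X) (S : set X) (TS : set_fun S S T)
    (x : S) : set_val (restriction TS x) = T (set_val x).
Proof. by rewrite !set_valE. Qed.

(* Main.v *)
Require Import Defs.
From mathcomp Require Import all_boot all_order all_algebra.
From mathcomp Require Import all_classical all_reals all_analysis.
From mathcomp Require Import lra.

Import Order.TTheory GRing.Theory Num.Theory.
Import numFieldNormedType.Exports.

Local Open Scope classical_set_scope.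
Local Open Scope ring_scope.

(** The map [T] is not assumed continuous, so a limit of iterates has no
automatic reason to be fixed; the two clauses in the definition of a universal
iterative contraction make up for this.

From contractions to convergence, inside one complete invariant piece. The
clause about a point and its own orbit first bounds every orbit
([orbit_bounded]), and then, applied repeatedly, produces tails of the orbit
staying within a constant times [k ^+ j] of their first point ([orbit_tails]);
so every orbit is Cauchy and converges ([orbit_cvg]). The clause about distinct points,
applied repeatedly to a pair, shows that all orbits have the same limit [z]
([orbit_limit_unique]). In particular the orbit of [z] itself tends to [z].
Letting [n] go to infinity in the own-orbit clause at [z] gives
[iter N T z = z] for some positive [N]. Then [T z] is periodic as well, and a
periodic point whose orbit tends to [z] is equal to [z] ([periodic_limit]).

From convergence to contractions. The pieces are the sets consisting of an
orbit together with its limit [z]. Such a set is compact, hence closed and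
complete, and it is invariant because [z] is fixed. All orbits in it tend to
[z], and this alone makes [T] a universal iterative contraction for every
constant strictly between 0 and 1
([universal_iterative_contraction_of_cvg]): the left-hand sides of the two
inequalities become arbitrarily small, while the right-hand sides stay away
from 0, since a point other than [z] is never approached again by its own
orbit; at [z] itself both sides of the own-orbit inequality vanish. *)

(** * Convergence and smallness *)

Lemma cvg_mdistP (R : realType) (M : metricType R) (u : nat -> M) (z : M) :
  u @ \oo --> z <->
  forall e : R, 0 < e -> exists N : nat, forall n, (N <= n)%N ->
    mdist z (u n) < e.
Proof.
split=> [/cvg_ballP uz e e0|uz].
  have [N _ Nu] := uz e e0.
  by exists N => n Nn; have := Nu n Nn; rewrite /= ballEmdist.
apply/cvg_ballP => e e0; have [N Nu] := uz e e0.
by exists N => // n Nn /=; rewrite ballEmdist; exact: Nu.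
Qed.

Lemma mdist_le_small (R : realType) (M : metricType R) (x y : M) :
  (forall e : R, 0 < e -> mdist x y <= e) -> x = y.
Proof.
move=> xy; apply: mdist_positivity; apply/eqP.
rewrite eq_le mdist_ge0 andbT.
by apply/ler_addgt0Pl => e e0; rewrite addr0; exact: xy.
Qed.

Lemma geometric_small (R : realType) (k B e : R) : 0 <= k < 1 -> 0 < e ->
  exists J : nat, forall j, (J <= j)%N -> k ^+ j * B < e.
Proof.
move=> /andP[k0 k1] e0.
have k1' : `|k| < 1 by rewrite ger0_norm.
have /cvgrPdist_lt/(_ e e0)[J _ HJ] := cvg_geometric B k1'.
exists J => j Jj; have := HJ j Jj; rewrite /= sub0r normrN mulrC.
exact/le_lt_trans/ler_norm.
Qed.

Lemma positive_lower_bound (R : realType) (f : nat -> R) (N : nat) :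
  (forall n, (0 < n)%N -> 0 < f n) ->
  exists2 d : R, 0 < d & forall n, (0 < n < N)%N -> d <= f n.
Proof.
move=> f0; elim: N => [|N [d d0 dN]]; first by exists 1 => // n; rewrite andbF.
case: N dN => [|N] dN; first by exists d => // -[].
exists (Num.min d (f N.+1)); first by rewrite lt_min d0 f0.
move=> n /andP[n0]; rewrite ltnS leq_eqVlt => /orP[/eqP->|nN].
  by rewrite ge_min lexx orbT.
by rewrite ge_min dN ?n0.
Qed.

(** * Iterates of a self-map of a metric space *)

Section contraction_iterates.
Context {R : realType} {M : metricType R}.
Variable T : M -> M.

(** The constant value [x] recurs along the multiples of [n], so it must be the
limit. *)
Lemma periodic_limit (x z : M) (n : nat) : (0 < n)%N -> iter n T x = x ->
  (fun m => iter m T x) @ \oo --> z -> x = z.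
Proof.
move=> n0 nx /cvg_mdistP xz.
have nxj j : iter (j * n) T x = x.
  by elim: j => // j IH; rewrite mulSn iterD IH.
apply: mdist_le_small => e /xz[N /(_ (N * n)%N)].
by rewrite leq_pmulr// nxj metric_sym => /(_ isT)/ltW.
Qed.

(** Two iterates that are close to [z] are close to each other, so it is enough
to bound the right-hand sides below. For the own-orbit clause at a point
[x <> z], the distances from [x] to its iterates tend to [mdist x z > 0], and
none of them vanishes by [periodic_limit]; hence they have a positive lower
bound. *)
Lemma universal_iterative_contraction_of_cvg (z : M) (k : R) : T z = z ->
  (forall x, (fun n => iter n T x) @ \oo --> z) -> 0 < k < 1 ->
  universal_iterative_contraction T k.
Proof.
move=> Tz Tcvg /andP[k0 k1].
have iterz n : iter n T z = z by elim: n => //= n ->.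
have tail x e : 0 < e -> exists N, forall n, (N <= n)%N ->
    mdist z (iter n T x) < e by move: e; apply/cvg_mdistP.
have closeness a b e : mdist z a < e -> mdist z b < e -> mdist a b <= 2 * e.
  move=> za zb; apply: (le_trans (metric_triangle _ z _)).
  by rewrite (metric_sym a); lra.
split; first by rewrite (ltW k0).
- move=> x y /eqP xy.
  have e0 : 0 < k * mdist x y / 2 by rewrite divr_gt0// mulr_gt0// mdist_gt0.
  have [Nx Hx] := tail x _ e0; have [Ny Hy] := tail y _ e0.
  exists (maxn Nx Ny).+1; split=> //.
  apply: (le_trans (closeness _ _ _ (Hx _ _) (Hy _ _))).
  + by rewrite leqW// leq_maxl.
  + by rewrite leqW// leq_maxr.
  + by rewrite mulrC divfK.
- move=> x; have [->|xz] := eqVneq x z.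
    by exists 1%N; split=> // n n0; rewrite !iterz mdistxx mulr0.
  (* If [x] returned to itself it would be periodic, hence equal to [z]. *)
  have f0 n : (0 < n)%N -> 0 < mdist x (iter n T x).
    move=> n0; rewrite mdist_gt0; apply/eqP => nx.
    by move/eqP: xz; apply; exact: (periodic_limit _ _ _ n0 (esym nx)).
  have dxz : 0 < mdist x z by rewrite mdist_gt0.
  have [N HN] := tail x (mdist x z / 2) (divr_gt0 dxz (ltr0n _ 2)).
  have [d d0 dN] := positive_lower_bound _ (fun n => mdist x (iter n T x)) N f0.
  (* From the index [N] on, the orbit is within [mdist x z / 2] of [z], hence
     at least that far from [x]; [d] takes care of the earlier iterates. *)
  pose c := Num.min d (mdist x z / 2).
  have c0 : 0 < c by rewrite lt_min d0 divr_gt0.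
  have cle n : (0 < n)%N -> c <= mdist x (iter n T x).
    move=> n0; rewrite ge_min; have [nN|Nn] := ltnP n N.
      by rewrite dN ?n0.
    apply/orP; right; have := HN n Nn.
    have := metric_triangle x (iter n T x) z.
    rewrite (metric_sym (iter n T x) z); lra.
  have e0 : 0 < k * c / 2 by rewrite divr_gt0// mulr_gt0.
  have [P HP] := tail x _ e0.
  exists P.+1; split=> // n n0.
  apply: (@le_trans _ _ (2 * (k * c / 2))).
    by apply: closeness; apply: HP; rewrite ?leqW// leq_addr.
  by rewrite mulrC divfK// ler_pM2l// cle.
Qed.

Variable k : R.
Hypothesis Tk : universal_iterative_contraction T k.

(** With [N] given by the own-orbit clause at [x], the distance from [x] to its
[n]-th iterate is at most [S + k * mdist x (iter (n - N) T x)] when [N < n],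
where [S] bounds the distances up to [N]. The solution of [S + k * B = B] is
therefore a bound, by strong induction on [n]. *)
Lemma orbit_bounded (x : M) : exists B : R, forall n, mdist x (iter n T x) <= B.
Proof.
have [/andP[k0 k1] _ /(_ x)[N [N0 HN]]] := Tk.
pose S := \sum_(i < N.+1) mdist x (iter i T x).
pose B := S / (1 - k).
have k1' : 0 < 1 - k by lra.
have SB : S = (1 - k) * B by rewrite mulrC divfK// gt_eqF.
have small n : (n <= N)%N -> mdist x (iter n T x) <= S.
  move=> nN; rewrite /S (bigD1 (Ordinal (nN : (n < N.+1)%N)))//= lerDl.
  by apply: sumr_ge0 => i _; exact: mdist_ge0.
have B0 : 0 <= B.
  rewrite divr_ge0 ?(ltW k1')//.
  exact: (le_trans (mdist_ge0 _ _) (small 0%N isT)).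
exists B => n; elim/ltn_ind: n => n IH.
have [nN|Nn] := leqP n N.
  by have := small n nN; have := mulr_ge0 k0 B0; lra.
have nN0 : (0 < n - N)%N by rewrite subn_gt0.
have nNn : (n - N < n)%N by rewrite ltn_subrL N0 (ltn_trans N0).
have := HN _ nN0; rewrite subnKC ?(ltnW Nn)// => H.
have := ler_wpM2l k0 (IH _ nNn).
have := metric_triangle x (iter N T x) (iter n T x).
have := small N (leqnn N).
by lra.
Qed.

(** Each application of the own-orbit clause at the current iterate shrinks its
distances to all its later iterates by the factor [k] at once. *)
Lemma orbit_tails (x : M) : exists B : R, forall j : nat, exists p : nat,
  forall n, mdist (iter p T x) (iter (p + n) T x) <= k ^+ j * B.
Proof.
have [B HB] := orbit_bounded x; exists B.
have [/andP[k0 _] _ H] := Tk.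
elim=> [|j [p Hp]]; first by exists 0%N => n; rewrite expr0 mul1r.
have [N [_ HN]] := H (iter p T x).
exists (N + p)%N => -[|n].
  rewrite addn0 mdistxx mulr_ge0// ?exprn_ge0//.
  exact: (le_trans (mdist_ge0 _ _) (HB 0%N)).
rewrite addnAC (iterD N) (iterD (N + n.+1)).
apply: (le_trans (HN _ (ltn0Sn n))).
by rewrite exprS -mulrA ler_wpM2l// -iterD addnC.
Qed.

Lemma orbit_cvg (x : M) : complete_space M ->
  exists z : M, (fun n => iter n T x) @ \oo --> z.
Proof.
have [k01 _ _] := Tk; have [B HB] := orbit_tails x.
apply; apply: cauchy_exP => e e0.
have [J HJ] := geometric_small _ k B e k01 e0.
have [p Hp] := HB J; exists (iter p T x).
exists p => // n /= pn; rewrite ballEmdist /= -(subnKC pn).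
exact: (le_lt_trans (Hp _) (HJ _ (leqnn _))).
Qed.

(** Iterating the clause about distinct points brings the two orbits within
[k ^+ j * mdist x y] of each other at arbitrarily late common times. *)
Lemma orbit_limit_unique (x y a b : M) :
  (fun n => iter n T x) @ \oo --> a -> (fun n => iter n T y) @ \oo --> b ->
  a = b.
Proof.
move=> /cvg_mdistP xa /cvg_mdistP yb; have [k01 H _] := Tk.
have /andP[k0 _] := k01.
have close j : exists2 p, (j <= p)%N &
    mdist (iter p T x) (iter p T y) <= k ^+ j * mdist x y.
  elim: j => [|j [p jp Hp]]; first by exists 0%N => //; rewrite expr0 mul1r.
  have [exy|/eqP nxy] := eqVneq (iter p T x) (iter p T y).
    (* Orbits that have met stay together, so one further step is harmless. *)
    exists p.+1 => //=.
    by rewrite exy mdistxx mulr_ge0 ?exprn_ge0 ?mdist_ge0.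
  have [N [N0 HN]] := H _ _ nxy.
  exists (N + p)%N; first by rewrite -add1n leq_add.
  by rewrite !iterD (le_trans HN)// exprS -mulrA ler_wpM2l.
apply: mdist_le_small => e e0.
have e3 : 0 < e / 3 by rewrite divr_gt0.
have [Nx Hx] := xa _ e3; have [Ny Hy] := yb _ e3.
have [J HJ] := geometric_small _ k (mdist x y) _ k01 e3.
have [p jp Hp] := close (maxn J (maxn Nx Ny)).
move: (jp); rewrite !geq_max => /and3P[_ xp yp].
have := Hx p xp; have := Hy p yp; have := HJ _ (leq_maxl J (maxn Nx Ny)).
have := metric_triangle a (iter p T x) b.
have := metric_triangle (iter p T x) (iter p T y) b.
by rewrite (metric_sym (iter p T y) b); lra.
Qed.

Lemma orbit_cvg_fixed (x : M) : complete_space M ->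
  exists z : M, T z = z /\ (fun n => iter n T x) @ \oo --> z.
Proof.
move=> cM; have [z xz] := orbit_cvg x cM; exists z; split=> //.
have allz y : (fun n => iter n T y) @ \oo --> z.
  have [w yw] := orbit_cvg y cM.
  by rewrite (orbit_limit_unique _ _ _ _ xz yw).
have [/andP[k0 k1] _ /(_ z)[N [N0 HN]]] := Tk.
(* [N] does not depend on [n] in the own-orbit clause, so both sides may be
   passed to the limit in [n]: the right-hand side tends to 0. *)
have Nz : iter N T z = z.
  have /cvg_mdistP zz := allz z.
  apply: mdist_le_small => e e0.
  have e2 : 0 < e / 2 by rewrite divr_gt0.
  have [P HP] := zz _ e2.
  have := HN P.+1 isT; have := HP P.+1 (leqnSn P).
  have := HP (N + P.+1)%N (leq_trans (leqnSn P) (leq_addl _ _)).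
  have := metric_triangle (iter N T z) (iter (N + P.+1) T z) z.
  rewrite (metric_sym (iter (N + P.+1) T z) z).
  have := ler_wpM2r (mdist_ge0 z (iter P.+1 T z)) (ltW k1).
  lra.
have NTz : iter N T (T z) = T z by rewrite -iterSr iterS Nz.
exact: (periodic_limit _ _ _ N0 NTz (allz _)).
Qed.

End contraction_iterates.

Lemma iter_restriction (X : Type) (T : X -> X) (S : set X)
    (TS : set_fun S S T) (x : S) (n : nat) :
  set_val (iter n (restriction TS) x) = iter n T (set_val x).
Proof. by elim: n => //= n IH; rewrite restrictionE IH. Qed.

(** * Compact subsets as complete subspaces *)

(** A filter that does not cluster at [z] avoids some neighbourhood of [z], and
so lives on finitely many terms of the sequence. *)
Lemma compact_cvg_range (X : topologicalType) (u : nat -> X) (z : X) :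
  u @ \oo --> z -> compact (range u `|` [set z]).
Proof.
move=> uz F FF FS.
have [Fz|] := pselect (cluster F z); first by exists z; split=> //; right.
move=> /existsNP[A /existsNP[B /not_implyP[FA /not_implyP[zB AB]]]].
have [N _ HN] := uz B zB.
have fin : finite_set (u @` `I_N) by exact/finite_image/finite_II.
have FuN : F (u @` `I_N).
  apply: filterS (filterI FA FS) => y [Ay [[n _ uny]|yz]].
    exists n => //=; rewrite ltnNge; apply/negP => Nn; apply: AB.
    by exists y; split=> //; rewrite -uny; exact: HN.
  by case: AB; exists y; split=> //; rewrite yz; exact: nbhs_singleton.
have [p [[n _ unp] Fp]] := finite_compact fin FF FuN.
by exists p; split=> //; left; exists n.
Qed.

(** A Cauchy filter on the subspace is pushed to the ambient space, where
compactness yields a cluster point in [S]; a Cauchy filter converges to each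
of its cluster points. *)
Lemma compact_complete_space (R : realType) (X : metricType R) (S : set X) :
  compact S -> complete_space (set_type S).
Proof.
move=> cS F FF /cauchy_ballP cF.
have FS : (fmap set_val F) S.
  by rewrite /fmap /=; apply: filterE => x; exact: set_valP.
have [p [Sp Fp]] := cS _ _ FS.
exists (exist _ p (mem_set Sp)); apply/cvg_ballP => e e0.
have e2 : 0 < e / 2 by rewrite divr_gt0.
have [[A B] /= [FA FB] AB] := cF _ e2.
have FvA : (fmap set_val F) (set_val @` A).
  by apply: filterS FA => x Ax; exists x.
have [_ [[x Ax <-] px]] := Fp _ _ FvA (nbhsx_ballx p _ e2).
apply: filterS FB => y By; have := AB (x, y) (conj Ax By); move: px.
rewrite /= !ballEmdist /= => px xy.
rewrite [e]splitr (le_lt_trans (metric_triangle _ (set_val x) _))//.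
by rewrite ltrD.
Qed.


(** * The equivalence *)

Theorem theorem6 (R : realType) (X : metricType R) (T : X -> X) :
  (exists C : set (set X),
     \bigcup_(S in C) S = setT /\
     forall S : set X, C S ->
       [/\ closed S,
           complete_space (set_type S)
         & exists TS : set_fun S S T, exists k : R,
             0 < k < 1 /\
             universal_iterative_contraction (restriction TS) k])
  <->
  (forall x : X, exists z : X,
     T z = z /\ (fun n : nat => iter n T x) @ \oo --> z).
Proof.
split=> [[C [CT HC]] x|Tcvg].
  have : setT x by []; rewrite -CT => -[S CS Sx].
  have [_ cS [TS [k [_ Tk]]]] := HC S CS.
  have [z [Tz xz]] := orbit_cvg_fixed _ _ Tk (exist _ x (mem_set Sx)) cS.
  exists (set_val z); split; first by rewrite -(restrictionE TS) Tz.
  move/cvg_mdistP: xz => xz; apply/cvg_mdistP => e /xz[N HN].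
  exists N => n /HN; rewrite [X in X < _]/mdist /= /sub_mdist iter_restriction.
  by rewrite !set_valE.
pose orbit_closure x z := range (fun n => iter n T x) `|` [set z].
exists [set S | exists x z, [/\ T z = z, (fun n => iter n T x) @ \oo --> z &
  S = orbit_closure x z]]; split.
  apply/seteqP; split=> // x _; have [z [Tz xz]] := Tcvg x.
  by exists (orbit_closure x z); [exists x, z|left; exists 0%N].
move=> _ [x [z [Tz xz ->]]]; set S := orbit_closure x z.
have cS : compact S by exact: compact_cvg_range.
have TS : set_fun S S T.
  move=> y [[n _ <-]|->]; last by right.
  by left; exists n.+1.
split; first exact: (compact_closed (@metric_hausdorff _ _)).
  exact: compact_complete_space.
have k2 : 0 < (2^-1 : R) < 1 by lra.
exists TS, 2^-1; split=> //.
have Sz : S z by right.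
pose zS : S := exist _ z (mem_set Sz).
apply: (universal_iterative_contraction_of_cvg _ zS) => //.
  by apply: val_inj; rewrite -!set_valE restrictionE.
move=> y; apply/cvg_mdistP => e e0.
have : S (set_val y) by exact: set_valP.

case=> [[m _ my]|yz].
  have [N HN] := (cvg_mdistP _ _ _ _).1 xz _ e0.
  exists N => n Nn; rewrite [X in X < _]/mdist /= /sub_mdist iter_restriction.
  by rewrite -my -iterD !set_valE /=; apply: HN; exact: leq_trans Nn (leq_addr _ _).
exists 0%N => n _; rewrite [X in X < _]/mdist /= /sub_mdist iter_restriction.
rewrite yz !set_valE /=.
have -> : iter n T z = z by elim: n => //= n ->.
by rewrite mdistxx.
Qed.
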